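(* Let $K$ be an interface element that is a trirectangular tetrahedron or a regular tetrahedron, with edges $e_1,\dots,e_6$ and unit tangent vectors $\mathbf{t}_i$ to $e_i$ (with an assigned orientation). Then the space $\mathbf{S}^e_h(K)$ has the degrees of freedom $\int_{e_i}\mathbf{v}_h\cdot\mathbf{t}_i\,ds$, $i=1,\dots,6$; that is, for any $v_1,\dots,v_6\in\mathbb{R}$ there is a unique $\mathbf{v}_h\in\mathbf{S}^e_h(K)$ with $\int_{e_i}\mathbf{v}_h\cdot\mathbf{t}_i\,ds=v_i$ for $i=1,\dots,6$.
   Context: A trirectangular tetrahedron is one with three mutually orthogonal faces. An interface element is a tetrahedron $K$ with an affine function $\varphi_h$ on $K$ (the linear interpolant of the interface's level-set function) whose values at the four vertices satisfy $\min\varphi_h\cdot\max\varphi_h<0$. The plane piece $\Gamma_h^K=\{\varphi_h=0\}\cap K$ divides $K$ into two subelements $K_h^+$ and $K_h^-$. $\alpha_h$ and $\beta_h$ equal the positive constants $\alpha^\pm$ and $\beta^\pm$, respectively, on $K_h^\pm$. $\mathbf{x}_K$ is a fixed point of $\Gamma_h^K$. $\mathbf{A}_h(K)$ is the space of vector fields $\mathbf{c}$ with $\mathbf{c}^\pm=\mathbf{c}|_{K_h^\pm}$ constant, $\mathbf{c}\in\mathbf{H}(\operatorname{div};K)$ and $\alpha_h\mathbf{c}\in\mathbf{H}(\operatorname{curl};K)$; $\mathbf{B}_h(K)$ is the space of vector fields $\mathbf{c}$ with $\mathbf{c}^\pm$ constant, $\mathbf{c}\in\mathbf{H}(\operatorname{curl};K)$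 and $\beta_h\mathbf{c}\in\mathbf{H}(\operatorname{div};K)$. Equivalently, $\mathbf{c}^-=A_K\mathbf{c}^+$ and $\mathbf{c}^-=B_K\mathbf{c}^+$ respectively, where $A_K=T_K\,\mathrm{diag}(1,\tilde\alpha,\tilde\alpha)\,T_K^\top$, $B_K=T_K\,\mathrm{diag}(\tilde\beta,1,1)\,T_K^\top$, $\tilde\alpha=\alpha^+/\alpha^-$, $\tilde\beta=\beta^+/\beta^-$, $T_K=[\bar{\mathbf{n}}_K,\bar{\mathbf{t}}_{K,1},\bar{\mathbf{t}}_{K,2}]$ with $\bar{\mathbf{n}}_K$ the unit normal and $\bar{\mathbf{t}}_{K,1},\bar{\mathbf{t}}_{K,2}$ two orthogonal unit tangent vectors to $\Gamma_h^K$. $\mathbf{S}^e_h(K)=\{\mathbf{a}_h\times(\mathbf{x}-\mathbf{x}_K)+\mathbf{b}_h:\ \mathbf{a}_h\in\mathbf{A}_h(K),\ \mathbf{b}_h\in\mathbf{B}_h(K)\}$. (The tangential component of such a function is single-valued across $\Gamma_h^K$, and edge integrals are taken piecewise.) *)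

(* Defs.v *)
From HB Require Import structures.
From mathcomp Require Export all_boot all_order all_algebra.
From mathcomp Require Export all_classical all_reals all_analysis.

Set Implicit Arguments.
Unset Strict Implicit.
Unset Printing Implicit Defensive.

Import Order.TTheory GRing.Theory Num.Theory.

Local Open Scope classical_set_scope.
Local Open Scope ring_scope.

Section Vectors.
Variable R : realType.
Implicit Types u v : 'cV[R]_3.

Definition dotp u v : R := \sum_(i < 3) u i 0 * v i 0.

(* [`|u|] on matrices is the max norm, hence a separate Euclidean norm. *)
Definition enorm u : R := Num.sqrt (dotp u u).

Definition crossp u v : 'cV[R]_3 :=
  \col_i (u (i + 1) 0 * v (i + 2) 0 - u (i + 2) 0 * v (i + 1) 0).

Definition is_affine (f : 'cV[R]_3 -> R) : Prop :=
  exists (g : 'cV[R]_3) (c : R), forall x, f x = dotp g x + c.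

End Vectors.

Section Tetrahedra.
Variable R : realType.
Implicit Types p : 'I_4 -> 'cV[R]_3.

Definition affinely_independent p : bool :=
  row_free (\matrix_(i < 3) (p (lift ord0 i) - p ord0)^T).

Definition tetra p : set 'cV[R]_3 :=
  [set x | exists l : 'I_4 -> R, [/\ forall i, 0 <= l i,
    \sum_i l i = 1 & x = \sum_i l i *: p i]].

(* Normal (of any length and sign) to the face opposite to the vertex [p i]. *)
Definition face_normal p (i : 'I_4) : 'cV[R]_3 :=
  crossp (p (lift i 1) - p (lift i 0)) (p (lift i 2) - p (lift i 0)).

Definition trirectangular p : Prop :=
  exists i j k : 'I_4, [/\ uniq [:: i; j; k],
    dotp (face_normal p i) (face_normal p j) = 0,
    dotp (face_normal p i) (face_normal p k) = 0 &
    dotp (face_normal p j) (face_normal p k) = 0].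

Definition regular p : Prop :=
  exists d : R, forall i j : 'I_4, i != j -> enorm (p i - p j) = d.

Definition edges : 6.-tuple ('I_4 * 'I_4) :=
  [tuple (0, 1); (0, 2); (0, 3); (1, 2); (1, 3); (2, 3)].

Definition edge_start p (k : 'I_6) : 'cV[R]_3 := p (tnth edges k).1.
Definition edge_end p (k : 'I_6) : 'cV[R]_3 := p (tnth edges k).2.
Definition edge_vec p (k : 'I_6) : 'cV[R]_3 := edge_end p k - edge_start p k.

(* Either of the two orientations is allowed. *)
Definition unit_tangent p (k : 'I_6) (t : 'cV[R]_3) : Prop :=
  enorm t = 1 /\ exists c : R, t = c *: edge_vec p k.

(* Integral over the edge [k] of the tangential component of [v] along [t],
   with respect to arc length. The Lebesgue integral of a piecewise affine
   integrand is the sum of the integrals over its pieces. *)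
Definition edge_dof p (k : 'I_6) (t : 'cV[R]_3)
    (v : 'cV[R]_3 -> 'cV[R]_3) : R :=
  let len := enorm (edge_vec p k) in
  \int[@lebesgue_measure R]_(s in `[0, len])
    dotp (v (edge_start p k + (s / len) *: edge_vec p k)) t.

End Tetrahedra.

Section InterfaceElement.
Variables (R : realType) (p : 'I_4 -> 'cV[R]_3) (phi : 'cV[R]_3 -> R).

Definition interface_element : Prop :=
  [/\ affinely_independent p, is_affine phi &
   (\big[Num.min/phi (p ord0)]_(i < 4) phi (p i)) *
   (\big[Num.max/phi (p ord0)]_(i < 4) phi (p i)) < 0].

Definition interface : set 'cV[R]_3 := tetra p `&` [set x | phi x = 0].

(* The interface itself is put into the plus part, so that a piecewise defined
   field has a value everywhere. The edge integrals of the fields considered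
   do not depend on this choice: an edge not contained in the interface meets
   it in at most one point, and for an edge contained in the interface only
   the tangential component matters, which is single-valued there. *)
Definition Kplus : set 'cV[R]_3 := tetra p `&` [set x | 0 <= phi x].
Definition Kminus : set 'cV[R]_3 := tetra p `&` [set x | phi x < 0].

Definition interface_frame (n t1 t2 : 'cV[R]_3) : Prop :=
  [/\ (forall x y, interface x -> interface y -> dotp n (x - y) = 0),
      [/\ enorm n = 1, enorm t1 = 1 & enorm t2 = 1] &
      [/\ dotp n t1 = 0, dotp n t2 = 0 & dotp t1 t2 = 0]].

Definition frame_mx (n t1 t2 : 'cV[R]_3) : 'M[R]_3 :=
  row_mx n (row_mx t1 t2).

Definition diag3 (a b c : R) : 'M[R]_3 :=
  diag_mx (\row_(j < 3) tnth [tuple a; b; c] j).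

Definition A_mx (T : 'M[R]_3) (alphap alpham : R) : 'M[R]_3 :=
  T *m diag3 1 (alphap / alpham) (alphap / alpham) *m T^T.

Definition B_mx (T : 'M[R]_3) (betap betam : R) : 'M[R]_3 :=
  T *m diag3 (betap / betam) 1 1 *m T^T.

(* Fields on K that are constant on each subelement, with values related by
   [c^- = M c^+]. The values of [c] outside K are irrelevant. *)
Definition transmission_space (M : 'M[R]_3) : set ('cV[R]_3 -> 'cV[R]_3) :=
  [set c | exists cp cm : 'cV[R]_3, [/\ cm = M *m cp,
     (forall x, Kplus x -> c x = cp) & (forall x, Kminus x -> c x = cm)]].

(* [c^- = A_mx c^+] says that the normal component of [c] and the tangential
   components of [alpha c] do not jump, i.e., that [c] is in H(div) and
   [alpha c] is in H(curl). *)
Definition A_space (T : 'M[R]_3) (alphap alpham : R) :=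
  transmission_space (A_mx T alphap alpham).

(* Likewise, [c] is in H(curl) and [beta c] is in H(div). *)
Definition B_space (T : 'M[R]_3) (betap betam : R) :=
  transmission_space (B_mx T betap betam).

Definition edge_space (T : 'M[R]_3) (alphap alpham betap betam : R)
    (xK : 'cV[R]_3) : set ('cV[R]_3 -> 'cV[R]_3) :=
  [set v | exists a b, [/\ A_space T alphap alpham a, B_space T betap betam b &
     forall x, tetra p x -> v x = crossp (a x) (x - xK) + b x]].

End InterfaceElement.

(* Main.v *)
Require Import Defs.
From HB Require Import structures.
From mathcomp Require Import all_boot all_order all_algebra fingroup perm.
From mathcomp Require Import all_classical all_reals all_analysis.
From mathcomp Require Import ring lra measurable_realfun.

Set Implicit Arguments.
Unset Strict Implicit.
Unset Printing Implicit Defensive.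

Import Order.TTheory GRing.Theory Num.Theory.
Import numFieldNormedType.Exports.

Local Open Scope classical_set_scope.
Local Open Scope ring_scope.

(** The proof uses of the shape of [K] only that no dihedral angle is obtuse.
    A field [crossp a (x - xK) + b] of the space is determined by the six
    coordinates of the values [a+] and [b+] on the plus side, so by linearity
    it suffices to show that these vanish if all the edge integrals do
    ([linear_inj_surj]).

    Along an edge the tangential component of the field is constant on
    each side of the interface, so that the edge integral is a weighted mean
    of two numbers ([edge_circ], [edge_dofE]); the weight of the minus side is
    the fraction [edge_frac] of the edge on which [phi < 0].

    The field [a].  Summing over the edges of a face eliminates [b], which
    contributes a difference of vertex values, and leaves the flux of [a]
    through the face.  If [f] denotes the values of [phi] at the vertices, the
    fraction of the face opposite to the vertex [l] on which [phi < 0] has the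
    form [rho + kap * f l], with the same [rho] and [kap] for the four faces
    ([edge_frac_split]).  Write [a+ = tau + s n] with [tau] tangential to the
    interface, [c = alpha+ / alpha-], and [q l] for the gradient of the [l]-th
    barycentric coordinate, up to a constant factor.  The vanishing of the
    flux becomes ([face_flux_eq0])

      [d l * (tau . q l) + s (n . q l) = 0],
      [d l = 1 + (c - 1) (rho + kap * f l) > 0].

    Multiply by [(f l - f 0) / d l] and sum over [l].  The terms in [tau] add
    up to a multiple of [tau . n = 0], hence [s] times the sum of
    [zeta l * (q l . n)] vanishes, where [zeta = (f - f 0) / d] is a strictly
    increasing function of [f], because [d] is affine in [f] and positive.
    For a strictly increasing [zeta] that sum cannot vanish: it is
    proportional to the Dirichlet form of the linear interpolants of [zeta]
    and [f], which equals the sum over the edges of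
    [- (q i . q j) (zeta i - zeta j) (f i - f j)] ([dirichlet_form]), where
    every term is nonnegative since the dihedral angles are not obtuse
    ([dirichlet_neq0]).  Therefore [s = 0], then [tau . q l = 0] for all [l],
    and [a = 0].

    The field [b].  With [a = 0], the values [b+ . p i] are, up to a constant,
    a multiple of [min (f i) 0], and the same argument with
    [zeta i = f i + (beta+ / beta- - 1) min (f i) 0], which is again strictly
    increasing, gives [n . b+ = 0] and then [b+ = 0]. *)

(** * Sums over three and four indices *)

Lemma ord3_ind (P : 'I_3 -> Prop) : P 0 -> P 1 -> P 2 -> forall i, P i.
Proof.
move=> P0 P1 P2 [[|[|[|//]]] hi].
- by rewrite (_ : Ordinal hi = 0) //; apply/val_inj.
- by rewrite (_ : Ordinal hi = 1) //; apply/val_inj.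
- by rewrite (_ : Ordinal hi = 2) //; apply/val_inj.
Qed.

Lemma sum3E (V : zmodType) (F : 'I_3 -> V) : \sum_i F i = F 0 + F 1 + F 2.
Proof.
rewrite !big_ord_recl big_ord0 addr0 addrA.
by congr (_ + F _ + F _); apply/val_inj.
Qed.

Lemma ord4_ind (P : 'I_4 -> Prop) : P 0 -> P 1 -> P 2 -> P 3 -> forall i, P i.
Proof.
move=> P0 P1 P2 P3 [[|[|[|[|//]]]] hi].
- by rewrite (_ : Ordinal hi = 0) //; apply/val_inj.
- by rewrite (_ : Ordinal hi = 1) //; apply/val_inj.
- by rewrite (_ : Ordinal hi = 2) //; apply/val_inj.
- by rewrite (_ : Ordinal hi = 3) //; apply/val_inj.
Qed.

Lemma perm_ord4 (i j k l : 'I_4) :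
  uniq [:: i; j; k; l] -> perm_eq (index_enum 'I_4) [:: i; j; k; l].
Proof.
move=> us.
have card_s : #|[:: i; j; k; l]| = #|'I_4| by rewrite (card_uniqP us) card_ord.
apply: uniq_perm (index_enum_uniq _) us _ => x; rewrite mem_index_enum.
exact/esym/(subset_cardP card_s)/subset_predT.
Qed.

Lemma sum_ord4 (V : zmodType) (F : 'I_4 -> V) (i j k l : 'I_4) :
  uniq [:: i; j; k; l] -> \sum_m F m = F i + F j + F k + F l.
Proof.
move=> /perm_ord4 /(perm_big _) ->.
by rewrite !big_cons big_nil /= addr0 !addrA.
Qed.

Lemma sum4E (V : zmodType) (F : 'I_4 -> V) : \sum_i F i = F 0 + F 1 + F 2 + F 3.
Proof. exact: sum_ord4. Qed.

(** * Vectors of the three-dimensional space *)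

Section VectorAlgebra.
Variable R : realType.
Implicit Types (u v w z : 'cV[R]_3) (a b : R).

Lemma dotpE u v :
  dotp u v = u 0 0 * v 0 0 + u 1 0 * v 1 0 + u 2 0 * v 2 0.
Proof.
rewrite /dotp !big_ord_recl big_ord0 addr0 addrA.
by congr (_ + u _ _ * v _ _ + u _ _ * v _ _); apply/val_inj.
Qed.

Lemma crossp0E u v : crossp u v 0 0 = u 1 0 * v 2 0 - u 2 0 * v 1 0.
Proof. by rewrite mxE !add0r. Qed.

Lemma crossp1E u v : crossp u v 1 0 = u 2 0 * v 0 0 - u 0 0 * v 2 0.
Proof.
by rewrite mxE; congr (u _ _ * v _ _ - u _ _ * v _ _); apply/val_inj.
Qed.

Lemma crossp2E u v : crossp u v 2 0 = u 0 0 * v 1 0 - u 1 0 * v 0 0.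
Proof.
by rewrite mxE; congr (u _ _ * v _ _ - u _ _ * v _ _); apply/val_inj.
Qed.

Lemma cV3P u v :
  u 0 0 = v 0 0 -> u 1 0 = v 1 0 -> u 2 0 = v 2 0 -> u = v.
Proof.
by move=> h0 h1 h2; apply/matrixP => i j; rewrite ord1; elim/ord3_ind: i.
Qed.

(** Rewriting rules that reduce vector expressions to coordinates. *)
Definition coordE := (dotpE, crossp0E, crossp1E, crossp2E, mxE).

Lemma dotpC u v : dotp u v = dotp v u.
Proof. by rewrite !coordE; ring. Qed.
Lemma dotpDl u v w : dotp (u + v) w = dotp u w + dotp v w.
Proof. by rewrite !coordE; ring. Qed.
Lemma dotpDr u v w : dotp u (v + w) = dotp u v + dotp u w.
Proof. by rewrite !coordE; ring. Qed.
Lemma dotpBl u v w : dotp (u - v) w = dotp u w - dotp v w.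
Proof. by rewrite !coordE; ring. Qed.
Lemma dotpBr u v w : dotp u (v - w) = dotp u v - dotp u w.
Proof. by rewrite !coordE; ring. Qed.
Lemma dotpZl a u v : dotp (a *: u) v = a * dotp u v.
Proof. by rewrite !coordE; ring. Qed.
Lemma dotpZr a u v : dotp u (a *: v) = a * dotp u v.
Proof. by rewrite !coordE; ring. Qed.
Lemma dotpNl u v : dotp (- u) v = - dotp u v.
Proof. by rewrite !coordE; ring. Qed.
Lemma dotpNr u v : dotp u (- v) = - dotp u v.
Proof. by rewrite !coordE; ring. Qed.
Lemma dotp0l u : dotp 0 u = 0.
Proof. by rewrite !coordE; ring. Qed.
Lemma dotp0r u : dotp u 0 = 0.
Proof. by rewrite !coordE; ring. Qed.

Lemma dotp_suml (I : Type) (r : seq I) (P : pred I) (F : I -> 'cV[R]_3) u :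
  dotp (\sum_(i <- r | P i) F i) u = \sum_(i <- r | P i) dotp (F i) u.
Proof. exact: (big_morph _ (fun x y => dotpDl x y u) (dotp0l u)). Qed.

Lemma dotp_sumr (I : Type) (r : seq I) (P : pred I) (F : I -> 'cV[R]_3) u :
  dotp u (\sum_(i <- r | P i) F i) = \sum_(i <- r | P i) dotp u (F i).
Proof. exact: (big_morph _ (dotpDr u) (dotp0r u)). Qed.

Lemma dotp_ge0 u : 0 <= dotp u u.
Proof. by rewrite dotpE !addr_ge0 // -expr2 sqr_ge0. Qed.

Lemma dotp_eq0 u : (dotp u u == 0) = (u == 0).
Proof.
apply/eqP/eqP => [|->]; last by rewrite dotp0l.
rewrite dotpE -!expr2 => /eqP.
rewrite paddr_eq0 ?addr_ge0 ?sqr_ge0// paddr_eq0 ?sqr_ge0// !sqrf_eq0.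
move=> /andP[/andP[/eqP h0 /eqP h1] /eqP h2].
by apply: cV3P; rewrite mxE.
Qed.

Lemma enorm_sqr u : enorm u ^+ 2 = dotp u u.
Proof. by rewrite sqr_sqrtr ?dotp_ge0. Qed.

Lemma enorm_eq1 u : enorm u = 1 -> dotp u u = 1.
Proof. by rewrite -enorm_sqr => ->; rewrite expr1n. Qed.

(** The Binet-Cauchy identity. *)
Lemma dotp_crossp u v w z : dotp (crossp u v) (crossp w z) =
  dotp u w * dotp v z - dotp u z * dotp v w.
Proof. by rewrite !coordE; ring. Qed.

Lemma polarization u v :
  dotp u v = (dotp u u + dotp v v - dotp (u - v) (u - v)) / 2.
Proof. by rewrite !coordE; field. Qed.

(** The left-hand side is [dotp t g] times the determinant of [u], [v], [w]. *)
Lemma dotp_triple_tangent g t u v w :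
  dotp t g = 0 ->
  dotp g w * dotp t (crossp u v) + dotp g u * dotp t (crossp v w) +
  dotp g v * dotp t (crossp w u) = 0.
Proof.
move=> tg; transitivity (dotp (crossp u v) w * dotp t g); last by rewrite tg mulr0.
by rewrite !coordE; ring.
Qed.

End VectorAlgebra.

(** * Integral of a step function *)

(** The value of [f] at the jump is arbitrary. *)
Lemma Rintegral_step (R : realType) (f : R -> R) (L s A B : R) :
  0 <= s <= L ->
  (forall x, 0 <= x < s -> f x = A) -> (forall x, s < x <= L -> f x = B) ->
  \int[@lebesgue_measure R]_(x in `[0, L]) f x = A * s + B * (L - s).
Proof.
move=> /andP[s0 sL] fA fB.
have mu_itv b c (i j : R) : i <= j ->
    fine (lebesgue_measure [set` Interval (BSide b i) (BSide c j)]) = j - i.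
  move=> ij; rewrite lebesgue_measure_itv /= lte_fin.
  by case: ltgtP ij => // -> _; rewrite subrr.
have intf : (@lebesgue_measure R).-integrable `[0, L] (EFin \o f).
  apply: measurable_bounded_integrable => //.
  - by rewrite /= lebesgue_measure_itv /=; case: ifP => _; rewrite ?ltry // -EFinB ltry.
  - have eqf : {in `[0, L]%classic,
        (fun x => if x < s then A else if s < x then B else f s) =1 f}.
      move=> x /[!inE] /=; rewrite in_itv/= => /andP[x0 xL].
      by case: (ltgtP x s) => [xs|xs|->//]; [rewrite fA// x0|rewrite fB// xs].
    apply: (eq_measurable_fun _ eqf).
    apply: measurable_funTS; apply: measurable_fun_ifT; first exact: measurable_fun_ltr.
      exact: measurable_cst.
    by apply: measurable_fun_ifT; first exact: measurable_fun_ltr.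
  - exists (`|A| + `|B| + `|f s|); split; first exact: num_real.
    move=> M hM x /=; rewrite in_itv /= => /andP[x0 xL]; apply: le_trans (ltW hM).
    case: (ltgtP x s) => [xs|xs|->]; [rewrite fA ?x0//|rewrite fB ?xs//|].
    + by rewrite -addrA lerDl addr_ge0.
    + by rewrite addrAC lerDr addr_ge0.
    + by rewrite lerDr addr_ge0.
have eqA : \int[@lebesgue_measure R]_(x in `[0, s]) f x = A * s.
  rewrite -Rintegral_itv_bndo_bndc; last first.
    by apply: integrableS intf => // x /=; rewrite !in_itv/= => /andP[-> /ltW/le_trans->].
  rewrite (@eq_Rintegral _ _ _ _ _ (cst A)); last first.
    by move=> x /[!inE] /=; rewrite in_itv /=; exact: fA.
  by rewrite Rintegral_cst// mu_itv// subr0.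
have eqB : \int[@lebesgue_measure R]_(x in `]s, L]) f x = B * (L - s).
  rewrite (@eq_Rintegral _ _ _ _ _ (cst B)); last first.
    by move=> x /[!inE] /=; rewrite in_itv /=; exact: fB.
  by rewrite Rintegral_cst// mu_itv.
have := @Rintegral_itvB R f (BLeft 0) (BRight L) s intf.
by rewrite !bnd_simp eqA eqB => /(_ s0 sL) <-; rewrite addrC subrK.
Qed.

(** * Fractions of the edges and faces where an affine function is negative *)

(** Fraction of a segment on which an affine function with the values [a] and
    [b] at the endpoints is negative. It is the divided difference of
    [min t 0] at [a] and [b], extended to [a = b] by 1 if [a < 0] and by 0
    otherwise. *)
Definition edge_frac (R : realType) (a b : R) : R :=
  if a < 0 then (if b < 0 then 1 else a / (a - b))
  else (if b < 0 then b / (b - a) else 0).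

Lemma edge_fracC (R : realType) (a b : R) : edge_frac a b = edge_frac b a.
Proof. by rewrite /edge_frac; case: ifP; case: ifP. Qed.

Lemma edge_frac_min (R : realType) (x y : R) :
  edge_frac x y * (y - x) = Num.min y 0 - Num.min x 0.
Proof.
rewrite /edge_frac /Num.min; have [x0|x0] := ltP x 0; have [y0|y0] := ltP y 0.
- by rewrite mul1r.
- by field; rewrite lt_eqF//; lra.
- by field; rewrite lt_eqF//; lra.
- by rewrite mul0r subrr.
Qed.

(** The case of sorted values of [edge_frac_split]. The witnesses are divided
    differences at [a], [b], [c], [d]: [kap] is minus that of [(min t 0)^2],
    and [om] is that of [min t 0], both written without the factors that
    vanish when two values on the same side coincide. *)
Lemma edge_frac_split4 (R : realType) (a b c d : R) :
  a <= b -> b <= c -> c <= d ->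
  exists rho kap om : R, let fr x y := rho + kap * (x + y) + om * (x * y) in
    [/\ [/\ edge_frac a b = fr c d, edge_frac a c = fr b d
          & edge_frac a d = fr b c],
        [/\ edge_frac b c = fr a d, edge_frac b d = fr a c
          & edge_frac c d = fr a b]
      & 0 <= kap /\ 0 <= rho + kap * a /\ rho + kap * d <= 1].
Proof.
move=> ab bc cd; rewrite /edge_frac.
(* No negative value. *)
have [a0|a0] := ltP a 0; last first.
  have [b0 c0 d0] : [/\ 0 <= b, 0 <= c & 0 <= d] by split; lra.
  exists 0, 0, 0; rewrite /= !ltNge b0 c0 d0 /=.
  by split; [split; ring|split; ring|split=> //; lra].
(* Only [a] is negative. *)
have [b0|b0] := ltP b 0; last first.
  have [c0 d0] : [/\ 0 <= c & 0 <= d] by split; lra.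
  pose kap := a ^+ 2 / ((b - a) * (c - a) * (d - a)).
  have [hb hc hd] : [/\ 0 < b - a, 0 < c - a & 0 < d - a] by split; lra.
  have k0 : 0 <= kap by rewrite divr_ge0 ?sqr_ge0// !mulr_ge0 ?ltW.
  exists (- (kap * a)), kap, (- (a / ((b - a) * (c - a) * (d - a)))).
  rewrite /= !ltNge c0 d0 /=.
  have [n1 n2 n3] : [/\ a - b != 0, a - c != 0 & a - d != 0].
    by split; rewrite lt_eqF//; lra.
  have [n4 n5 n6] : [/\ b - a != 0, c - a != 0 & d - a != 0].
    by split; apply: lt0r_neq0.
  split; [split; rewrite /kap; field; do ?[apply/andP; split] => //
    |split; rewrite /kap; field; do ?[apply/andP; split] => //|].
  split=> //; split; first lra.
  rewrite -[leLHS](_ : (- a / (b - a)) * (- a / (c - a)) = _); last first.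
    by rewrite /kap; field; do ?[apply/andP; split].
  by apply: mulr_ile1; rewrite ?divr_ge0 ?ler_pdivrMr ?mul1r//; lra.
(* Exactly [a] and [b] are negative. *)
have [c0|c0] := ltP c 0; last first.
  have d0 : 0 <= d by lra.
  pose D := (c - a) * (d - a) * (c - b) * (d - b).
  pose kap := (a * b * (c + d) - c * d * (a + b)) / D.
  have [h1 h2 h3 h4] : [/\ 0 < c - a, 0 < d - a, 0 < c - b & 0 < d - b].
    by split; lra.
  have D0 : 0 < D by rewrite /D !mulr_gt0.
  have k0 : 0 <= kap.
    apply: divr_ge0; last exact: ltW.
    have : 0 <= a * b * (c + d).
      by rewrite mulr_ge0 ?addr_ge0// nmulr_lge0// ltW.
    have : 0 <= c * d * (- a - b).
      by rewrite mulr_ge0 ?mulr_ge0//; lra.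
    lra.
  have [m1 m2 m3 m4] : [/\ c - a != 0, d - a != 0, c - b != 0 & d - b != 0].
    by split; apply: lt0r_neq0.
  have [n1 n2 n3 n4] : [/\ a - c != 0, a - d != 0, b - c != 0 & b - d != 0].
    by rewrite -!(opprB c) -!(opprB d) !oppr_eq0.
  exists (b ^+ 2 / ((c - b) * (d - b)) - kap * a), kap, ((c * d - a * b) / D).
  rewrite /= !ltNge d0 /=; rewrite /kap /D.
  split; [split; field; do ?[apply/andP; split] => //
    |split; field; do ?[apply/andP; split] => //|split => //; split].
    by rewrite subrK divr_ge0 ?sqr_ge0 ?mulr_ge0 ?ltW.
  rewrite -subr_ge0 -[leRHS](_ : (c / (c - a)) * (c / (c - b)) = _); last first.
    by field; do ?[apply/andP; split].
  by apply: mulr_ge0; apply: divr_ge0 => //; apply: ltW.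
(* Only [d] is nonnegative. *)
have [d0|d0] := ltP d 0; last first.
  pose D := (d - a) * (d - b) * (d - c).
  have [h1 h2 h3] : [/\ 0 < d - a, 0 < d - b & 0 < d - c] by split; lra.
  have [m1 m2 m3] : [/\ d - a != 0, d - b != 0 & d - c != 0].
    by split; apply: lt0r_neq0.
  have [n1 n2 n3] : [/\ a - d != 0, b - d != 0 & c - d != 0].
    by rewrite -!(opprB d) !oppr_eq0.
  have D0 : 0 < D by rewrite /D !mulr_gt0.
  pose kap := d ^+ 2 / D.
  have k0 : 0 <= kap by rewrite divr_ge0 ?sqr_ge0 ?ltW.
  exists (1 - kap * d), kap, (- (d / D)); rewrite /= /kap /D.
  split; [split; field; do ?[apply/andP; split] => //
    |split; field; do ?[apply/andP; split] => //|].
  split=> //; split; last by rewrite subrK.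
  rewrite -[leRHS](_ : 1 - (d / (d - b)) * (d / (d - c)) = _); last first.
    by field; do ?[apply/andP; split].
  by rewrite subr_ge0; apply: mulr_ile1; rewrite ?divr_ge0 ?ler_pdivrMr ?mul1r//; lra.
(* All the values are negative. *)
by exists 1, 0, 0; rewrite /=; split; [split; ring|split; ring|split=> //; split; lra].
Qed.

Lemma exists_sorting (R : realType) (v : 'I_4 -> R) :
  exists s : 'S_4, forall i j : 'I_4, (i <= j)%N -> v (s i) <= v (s j).
Proof.
have /tuple_permP[s hs] : perm_eq (sort <=%R [tuple v i | i < 4]) [tuple v i | i < 4].
  by rewrite perm_sort.
exists s => i j ij /=.
have srt : sorted <=%R (sort <=%R [tuple v i | i < 4]).
  by apply: sort_sorted; exact: le_total.
have nthE (m : 'I_4) : v (s m) = nth 0 (sort <=%R [tuple v i | i < 4]) m.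
  by rewrite hs -tnth_nth !tnth_mktuple.
rewrite !nthE; apply: (sorted_leq_nth le_trans le_refl) => //;
  by rewrite inE size_sort size_tuple.
Qed.

(** For an affine function with the values [v] at the vertices of a
    tetrahedron and the witnesses of the proof, [rho + kap * v l] is the
    fraction of the face opposite to [l] on which the function is negative. *)
Lemma edge_frac_split (R : realType) (v : 'I_4 -> R) :
  exists rho kap om : R,
    (forall i j k l, uniq [:: i; j; k; l] ->
       edge_frac (v i) (v j) =
         rho + kap * (v k + v l) + om * (v k * v l)) /\
    (forall i, 0 <= rho + kap * v i <= 1).
Proof.
have [s homo_s] := exists_sorting v; set u := v \o s in homo_s.
have u01 : u 0 <= u 1 by exact: homo_s.
have u12 : u 1 <= u 2 by exact: homo_s.
have u23 : u 2 <= u 3 by exact: homo_s.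
have [rho [kap [om [[f01 f02 f03] [f12 f13 f23] [kap0 [lo hi]]]]]] :=
  edge_frac_split4 u01 u12 u23.
have vE i : v i = u (s^-1%g i) by rewrite /u /= permKV.
have frC := (etrans (edge_fracC _ _) f01, etrans (edge_fracC _ _) f02,
  etrans (edge_fracC _ _) f03, etrans (edge_fracC _ _) f12,
  etrans (edge_fracC _ _) f13, etrans (edge_fracC _ _) f23).
exists rho, kap, om; split=> [i j k l|i]; last first.
  rewrite vE; move: (s^-1%g i) => {}i.
  have ui : u 0 <= u i <= u 3 by rewrite !homo_s// -ltnS.
  case/andP: ui => /(ler_wpM2l kap0) ui0 /(ler_wpM2l kap0) ui3.
  by apply/andP; split; lra.
rewrite -(map_inj_uniq (@perm_inj _ s^-1%g)) /= !vE.
move: (s^-1%g i) (s^-1%g j) (s^-1%g k) (s^-1%g l) => {}i {}j {}k {}l.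
elim/ord4_ind: i; elim/ord4_ind: j => //; elim/ord4_ind: k => //;
  elim/ord4_ind: l => // _; rewrite (f01, f02, f03, f12, f13, f23, frC); ring.
Qed.

(** * Gradients of the barycentric coordinates *)

Section Geometry.
Variables (R : realType) (p : 'I_4 -> 'cV[R]_3).

(** Twice the area vector of the triangle with vertices [u], [v], [w]. *)
Definition area3 (u v w : 'cV[R]_3) := crossp u v + crossp v w + crossp w u.

(** Gradient of the barycentric coordinate of the vertex [p i], multiplied by
    [tvol]. The sign makes the normals of the four faces all inward or all
    outward. *)
Definition bary_grad (i : 'I_4) : 'cV[R]_3 := (-1) ^+ i.+1 *: face_normal p i.

(** Six times the signed volume of the tetrahedron. *)
Definition tvol : R := dotp (crossp (p 1 - p 0) (p 2 - p 0)) (p 3 - p 0).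

Lemma area3_transl (u v w x : 'cV[R]_3) :
  area3 (u - x) (v - x) (w - x) = area3 u v w.
Proof. by apply: cV3P; rewrite !coordE; ring. Qed.

Lemma bary_grad_area3 l :
  bary_grad l =
    (-1) ^+ l.+1 *: area3 (p (lift l 0)) (p (lift l 1)) (p (lift l 2)).
Proof. by congr (_ *: _); apply: cV3P; rewrite !coordE; ring. Qed.

Lemma uniq_lift4 (l : 'I_4) : uniq [:: lift l 0; lift l 1; lift l 2; l].
Proof. by elim/ord4_ind: l. Qed.

Lemma bary_gradE : [/\
  bary_grad 0 = - area3 (p 1) (p 2) (p 3),
  bary_grad 1 = area3 (p 0) (p 2) (p 3),
  bary_grad 2 = - area3 (p 0) (p 1) (p 3) &
  bary_grad 3 = area3 (p 0) (p 1) (p 2)].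
Proof.
rewrite !bary_grad_area3.
split; [rewrite expr1 scaleN1r; congr (- _)
  | rewrite sqrrN expr1n scale1r
  | rewrite exprSr sqrrN expr1n mul1r scaleN1r; congr (- _)
  | rewrite -[4%N]/(2 * 2)%N exprM sqrrN !expr1n scale1r];
  by congr (area3 (p _) (p _) (p _)); apply/val_inj.
Qed.

Lemma sum_bary_grad : \sum_i bary_grad i = 0.
Proof.
rewrite sum4E; case: bary_gradE => -> -> -> ->.
by apply: cV3P; rewrite !coordE; ring.
Qed.

(** The gradient of the linear interpolant of [x |-> u . x] is [u]. *)
Lemma sum_dotp_bary_grad u : \sum_i dotp u (p i) *: bary_grad i = tvol *: u.
Proof.
rewrite /tvol sum4E; case: bary_gradE => -> -> -> ->.
by apply: cV3P; rewrite !coordE; ring.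
Qed.

(** The transpose of [sum_dotp_bary_grad]. *)
Lemma sum_bary_coord u : \sum_i dotp u (bary_grad i) *: p i = tvol *: u.
Proof.
rewrite /tvol sum4E; case: bary_gradE => -> -> -> ->.
by apply: cV3P; rewrite !coordE; ring.
Qed.

Lemma tvol_neq0 : affinely_independent p -> tvol != 0.
Proof.
rewrite /affinely_independent row_free_unit => /mulmxV.
set M := \matrix_(_ < 3) _; set N := invmx M => MN.
have duality i j : dotp (p (lift ord0 i) - p ord0) (col j N) = (i == j)%:R.
  have := congr1 (fun A : 'M[R]_3 => A i j) MN; rewrite !mxE => <-.
  by apply: eq_bigr => k _; rewrite !mxE.
have E0 (i : 'I_3) (k : 'I_4) : k = lift ord0 i -> forall j,
  dotp (p k - p 0) (col j N) = (i == j)%:R by move=> -> j; rewrite -duality.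
have E2 : forall j, dotp (p 2 - p 0) (col j N) = ((1 : 'I_3) == j)%:R.
  by apply: E0; apply/val_inj.
have E3 : forall j, dotp (p 3 - p 0) (col j N) = ((2 : 'I_3) == j)%:R.
  by apply: E0; apply/val_inj.
(* If the volume vanishes, the expansion of the first column of [N] gives
   [bary_grad 1 = 0]. But [bary_grad 1] is the cross product of two edge
   vectors, whose scalar product with the cross product of the two dual columns
   of [N] is 1. *)
apply/eqP => vol0.
have := sum_dotp_bary_grad (col 0 N); rewrite vol0 scale0r sum4E.
have E1 : forall j, dotp (p 1 - p 0) (col j N) = ((0 : 'I_3) == j)%:R.
  by apply: E0; apply/val_inj.
have c1 : dotp (col 0 N) (p 1) = dotp (col 0 N) (p 0) + 1.
  by apply/eqP; rewrite addrC -subr_eq -dotpBr dotpC E1.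
have c2 : dotp (col 0 N) (p 2) = dotp (col 0 N) (p 0).
  by apply/eqP; rewrite -subr_eq0 -dotpBr dotpC E2.
have c3 : dotp (col 0 N) (p 3) = dotp (col 0 N) (p 0).
  by apply/eqP; rewrite -subr_eq0 -dotpBr dotpC E3.
rewrite c1 c2 c3 => sum0.
have b10 : bary_grad 1 = 0.
  have := sum_bary_grad; rewrite sum4E.
  move: sum0; move: (bary_grad 0) (bary_grad 1) (bary_grad 2) (bary_grad 3).
  move: (dotp (col 0 N) (p 0)) => x b0 b1 b2 b3 sum0 b_sum.
  rewrite -[RHS]sum0 -[LHS]add0r -[X in X + _ = _](scaler0 _ x) -b_sum.
  by apply/matrixP => i j; rewrite !mxE; ring.
have := dotp_crossp (p 2 - p 0) (p 3 - p 0) (col 1 N) (col 2 N).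
rewrite !E2 !E3 /= mulr0 subr0 mulr1.
have -> : crossp (p 2 - p 0) (p 3 - p 0) = bary_grad 1.
  by case: bary_gradE => _ -> _ _; apply: cV3P; rewrite !coordE; ring.
by rewrite b10 dotp0l => /eqP; rewrite eq_sym oner_eq0.
Qed.

(** The fourth gradient is minus the sum of the three orthogonal ones. *)
Lemma dotp_bary_grad_trirectangular i j :
  trirectangular p -> i != j -> dotp (bary_grad i) (bary_grad j) <= 0.
Proof.
case=> a [b [c [abc ab ac bc]]] ij.
have ort x y : dotp (face_normal p x) (face_normal p y) = 0 ->
    dotp (bary_grad x) (bary_grad y) = 0.
  by move=> xy; rewrite dotpZl dotpZr xy !mulr0.
have [d abcd] : exists d : 'I_4, uniq [:: a; b; c; d].
  by elim/ord4_ind: a abc {ab ac bc}; elim/ord4_ind: b => //;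
    elim/ord4_ind: c => // _;
    first [by exists 0|by exists 1|by exists 2|by exists 3].
have gd : bary_grad d = - (bary_grad a + bary_grad b + bary_grad c).
  by apply/eqP; rewrite -addr_eq0 addrC -sum_bary_grad (sum_ord4 _ abcd).
have {}ab := ort _ _ ab; have {}ac := ort _ _ ac; have {}bc := ort _ _ bc.
have ba := etrans (dotpC _ _) ab; have ca := etrans (dotpC _ _) ac.
have cb := etrans (dotpC _ _) bc.
have mem x : x \in [:: a; b; c; d].
  by rewrite -(perm_mem (perm_ord4 abcd)) mem_index_enum.
move: ij (mem i) (mem j); rewrite !inE => ij.
by case/or4P=> /eqP iE; case/or4P=> /eqP jE; move: ij; rewrite iE jE ?eqxx // => _;
  rewrite ?gd ?(dotpNl, dotpNr, dotpDl, dotpDr) ?(ab, ac, bc, ba, ca, cb)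
    ?addr0 ?add0r ?oppr_le0 ?dotp_ge0.
Qed.

Lemma dotp_bary_grad_regular i j :
  regular p -> i != j -> dotp (bary_grad i) (bary_grad j) <= 0.
Proof.
case=> d hd.
have sq (a b : 'I_4) : a != b -> dotp (p a - p b) (p a - p b) = d ^+ 2.
  by move=> ab; rewrite -enorm_sqr hd.
have half (a b : 'I_4) : a != 0 -> b != 0 -> a != b ->
    dotp (p a - p 0) (p b - p 0) = d ^+ 2 / 2.
  move=> a0 b0 ab; rewrite polarization !sq// (_ : p a - p 0 - _ = p a - p b).
    by rewrite sq//; field.
  by rewrite opprB addrA subrK.
case: bary_gradE => g0 g1 g2 g3.
have {}g1 : bary_grad 1 = crossp (p 2 - p 0) (p 3 - p 0).
  by rewrite g1; apply: cV3P; rewrite !coordE; ring.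
have {}g2 : bary_grad 2 = crossp (p 3 - p 0) (p 1 - p 0).
  by rewrite g2; apply: cV3P; rewrite !coordE; ring.
have {}g3 : bary_grad 3 = crossp (p 1 - p 0) (p 2 - p 0).
  by rewrite g3; apply: cV3P; rewrite !coordE; ring.
have {}g0 : bary_grad 0 = - (bary_grad 1 + bary_grad 2 + bary_grad 3).
  by apply/eqP; rewrite -addr_eq0 -sum_bary_grad sum4E !addrA.
have le0 : - (d ^+ 2 * d ^+ 2) / 4 <= 0.
  by rewrite pmulr_lle0 ?invr_gt0// oppr_le0 mulr_ge0 ?sqr_ge0.
move=> ij.
suff -> : dotp (bary_grad i) (bary_grad j) = - (d ^+ 2 * d ^+ 2) / 4 by [].
elim/ord4_ind: i ij; elim/ord4_ind: j => // _;
  rewrite ?g0 ?(dotpNl, dotpNr, dotpDl, dotpDr) ?g1 ?g2 ?g3 !dotp_crossp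
    ?sq// ?half//; by field.
Qed.

Lemma dotp_bary_grad_le0 i j : trirectangular p \/ regular p ->
  i != j -> dotp (bary_grad i) (bary_grad j) <= 0.
Proof.
by case=> hp; [exact: dotp_bary_grad_trirectangular|exact: dotp_bary_grad_regular].
Qed.

End Geometry.

(** * The Dirichlet form on a nonobtuse tetrahedron *)

Section Dirichlet.
Variables (R : realType) (q : 'I_4 -> 'cV[R]_3).
Hypothesis sum_q : \sum_i q i = 0.

(** For [q = bary_grad p], the left-hand side is a multiple of the integral over
    the tetrahedron of the product of the gradients of the linear interpolants
    of [a] and [b]. *)
Lemma dirichlet_form (a b : 'I_4 -> R) :
  let t i j := - dotp (q i) (q j) * ((a i - a j) * (b i - b j)) in
  dotp (\sum_i a i *: q i) (\sum_i b i *: q i) =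
    t 0 1 + t 0 2 + t 0 3 + t 1 2 + t 1 3 + t 2 3.
Proof.
have q0 : q 0 = - (q 1 + q 2 + q 3).
  by apply/eqP; rewrite -addr_eq0 !addrA -sum4E sum_q.
by rewrite /= !sum4E q0 !coordE; ring.
Qed.

(** For [q = bary_grad p] and [V = tvol p], the vector [g] is the gradient of
    the linear interpolant of [f]. *)
Lemma dirichlet_neq0 (f zeta : 'I_4 -> R) (g : 'cV[R]_3) (V : R) :
  (forall i j, i != j -> dotp (q i) (q j) <= 0) ->
  (forall i j, f i != f j -> 0 < (zeta i - zeta j) * (f i - f j)) ->
  V *: g = \sum_i f i *: q i -> V != 0 -> g != 0 ->
  \sum_i zeta i * dotp (q i) g != 0.
Proof.
move=> obt mon Vg V0; apply: contra_neq => sum0.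
have zf0 : dotp (\sum_i zeta i *: q i) (\sum_i f i *: q i) = 0.
  rewrite -Vg dotpZr dotp_suml; under eq_bigr do rewrite dotpZl.
  by rewrite sum0 mulr0.
pose t i j := - dotp (q i) (q j) * ((zeta i - zeta j) * (f i - f j)).
have t_ge0 i j : i != j -> 0 <= t i j.
  move=> ij; have [fij|/mon/ltW zf] := eqVneq (f i) (f j).
    by rewrite /t fij subrr !mulr0.
  by rewrite mulr_ge0// oppr_ge0 obt.
have t_eq0 i j : t i j = 0 -> - dotp (q i) (q j) * ((f i - f j) * (f i - f j)) = 0.
  have [->|/mon/lt0r_neq0 zf] := eqVneq (f i) (f j); first by rewrite subrr !mulr0.
  by move=> /eqP; rewrite mulf_eq0 (negbTE zf) orbF => /eqP ->; rewrite mul0r.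
move: zf0; rewrite dirichlet_form => /eqP.
rewrite -!/(t _ _) !paddr_eq0 ?addr_ge0 ?t_ge0// -!andbA.
case/and5P=> /eqP/t_eq0 e01 /eqP/t_eq0 e02 /eqP/t_eq0 e03 /eqP/t_eq0 e12.
case/andP=> /eqP/t_eq0 e13 /eqP/t_eq0 e23.
have : dotp (V *: g) (V *: g) = 0.
  by rewrite Vg dirichlet_form e01 e02 e03 e12 e13 e23 !addr0.
by move=> /eqP; rewrite dotp_eq0 scaler_eq0 (negbTE V0) => /eqP.
Qed.

End Dirichlet.

(** * Unisolvence on a nonobtuse tetrahedron *)

(** Integral of [dotp (crossp c (y - x) + d) (p j - p i)] over the parameter in [0, 1]
    of the edge from [p i] to [p j], for [c] and [d] equal to [am] and [bm] on
    the part of the edge where the linear interpolant of [f] is negative, and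
    to [ap] and [bp] on the rest. The integrand is constant on each part,
    because [dotp (crossp c (y - x)) (p j - p i)] is equal to
    [dotp c (crossp (p i - x) (p j - x))] for [y] on the edge. *)
Definition edge_circ (R : realType) (p : 'I_4 -> 'cV[R]_3) (f : 'I_4 -> R)
    (x ap am bp bm : 'cV[R]_3) (i j : 'I_4) : R :=
  let w := crossp (p i - x) (p j - x) in
  (1 - edge_frac (f i) (f j)) * (dotp ap w + dotp bp (p j - p i)) +
  edge_frac (f i) (f j) * (dotp am w + dotp bm (p j - p i)).

Lemma edge_circ_linear (R : realType) (p : 'I_4 -> 'cV[R]_3) f x z
    (ap am bp bm ap' am' bp' bm' : 'cV[R]_3) i j :
  edge_circ p f x (z *: ap + ap') (z *: am + am')
    (z *: bp + bp') (z *: bm + bm') i j =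
  z * edge_circ p f x ap am bp bm i j + edge_circ p f x ap' am' bp' bm' i j.
Proof. by rewrite /edge_circ /= !dotpDl !dotpZl; ring. Qed.

(** The six edges, with their orientations, determine the remaining pairs. *)
Lemma edge_circ_all (R : realType) (p : 'I_4 -> 'cV[R]_3) f x
    (ap am bp bm : 'cV[R]_3) :
  (forall k, edge_circ p f x ap am bp bm
     (tnth edges k).1 (tnth edges k).2 = 0) ->
  forall i j, edge_circ p f x ap am bp bm i j = 0.
Proof.
move=> circ0.
have anti i j :
    edge_circ p f x ap am bp bm j i = - edge_circ p f x ap am bp bm i j.
  by rewrite /edge_circ /= edge_fracC !coordE; ring.
have diag i : edge_circ p f x ap am bp bm i i = 0.
  by have := anti i i; lra.
have e01 : edge_circ p f x ap am bp bm 0 1 = 0 by exact: (circ0 0).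
have e02 : edge_circ p f x ap am bp bm 0 2 = 0 by exact: (circ0 1).
have e03 : edge_circ p f x ap am bp bm 0 3 = 0 by exact: (circ0 2).
have e12 : edge_circ p f x ap am bp bm 1 2 = 0 by exact: (circ0 3).
have e13 : edge_circ p f x ap am bp bm 1 3 = 0 by exact: (circ0 4).
have e23 : edge_circ p f x ap am bp bm 2 3 = 0 by exact: (circ0 5).
move=> i j; elim/ord4_ind: i; elim/ord4_ind: j => //;
  by rewrite anti ?(e01, e02, e03, e12, e13, e23) oppr0.
Qed.

(** [f] are the vertex values of an affine function of gradient [g] that
    vanishes at [x], [n] is the unit normal to its zero set, and [c], [beta]
    are the coefficient ratios. [a], [b] are the values on the plus side. *)
Section Unisolvence.
Variables (R : realType) (p : 'I_4 -> 'cV[R]_3) (f : 'I_4 -> R).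
Variables (g x n : 'cV[R]_3) (k c beta : R).
Hypothesis fE : forall i, f i = dotp g (p i - x).
Hypothesis nE : n = k *: g.
Hypothesis n1 : dotp n n = 1.
Hypotheses (c0 : 0 < c) (beta0 : 0 < beta).
Hypothesis vol : tvol p != 0.
(* No dihedral angle is obtuse. *)
Hypothesis obt :
  forall i j, i != j -> dotp (bary_grad p i) (bary_grad p j) <= 0.
Variables (a b : 'cV[R]_3).
Let tau := a - dotp n a *: n.
Let am := a + (c - 1) *: tau.
Let bm := b + ((beta - 1) * dotp n b) *: n.
Hypothesis circ0 : forall i j, edge_circ p f x a am b bm i j = 0.

Let k0 : k != 0.
Proof.
by apply: contra_eq_neq n1 => k0; rewrite nE k0 scale0r dotp0l eq_sym oner_eq0.
Qed.

Let g0 : g != 0.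
Proof.
by apply: contra_eq_neq n1 => g0; rewrite nE g0 scaler0 dotp0l eq_sym oner_eq0.
Qed.

Let tau_g : dotp tau g = 0.
Proof.
apply: (mulfI k0); rewrite mulr0 -dotpZr -nE dotpBl dotpZl n1 mulr1 dotpC.
exact: subrr.
Qed.

Let Vg : tvol p *: g = \sum_i f i *: bary_grad p i.
Proof.
rewrite -sum_dotp_bary_grad.
under [RHS]eq_bigr do rewrite fE dotpBr scalerBl.
by rewrite sumrB -scaler_sumr sum_bary_grad scaler0 subr0.
Qed.

Let circE i j : edge_circ p f x a am b bm i j =
  let w := crossp (p i - x) (p j - x) in
  dotp a w + (c - 1) * edge_frac (f i) (f j) * dotp tau w +
  dotp b (p j - p i) +
  (beta - 1) * dotp n b * k * (Num.min (f j) 0 - Num.min (f i) 0).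
Proof.
rewrite -edge_frac_min /edge_circ /am /bm.
rewrite 2?[dotp (a + _ *: _) _]dotpDl 2?[dotp (b + _ *: _) _]dotpDl !dotpZl.
have -> : f j - f i = dotp g (p j - p i) by rewrite !fE -dotpBr opprB addrA subrK.
rewrite /= [dotp n (p j - p i)](_ : _ = k * dotp g (p j - p i)); last first.
  by rewrite nE dotpZl.
ring.
Qed.

(** The sum of the edge integrals over the boundary of a face is, up to sign,
    twice the flux of the field [a] through that face. *)
Lemma face_flux_eq0 rho kap om :
  (forall i j k l, uniq [:: i; j; k; l] ->
    edge_frac (f i) (f j) = rho + kap * (f k + f l) + om * (f k * f l)) ->
  forall l, dotp a (bary_grad p l) +
    (c - 1) * (rho + kap * f l) * dotp tau (bary_grad p l) = 0.
Proof.
move=> fracE l; have u1 := uniq_lift4 l.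
have u2 : uniq [:: lift l 1; lift l 2; lift l 0; l] by elim/ord4_ind: (l).
have u3 : uniq [:: lift l 2; lift l 0; lift l 1; l] by elim/ord4_ind: (l).
move: (fracE _ _ _ _ u1) (fracE _ _ _ _ u2) (fracE _ _ _ _ u3).
rewrite bary_grad_area3 !dotpZr {u1 u2 u3}.
set i := lift l 0; set j := lift l 1; set m := lift l 2 => fr_ij fr_jm fr_mi.
set y := fun i => p i - x.
have := dotp_triple_tangent (y i) (y j) (y m) tau_g.
rewrite -!fE => tangent.
have := circE i j; have := circE j m; have := circE m i.
rewrite !circ0 /= -!/(y _) fr_ij fr_jm fr_mi -(area3_transl _ _ _ x) -!/(y _).
rewrite [_ * (_ * dotp tau _)]mulrCA -mulrDr /area3 !dotpDr !dotpNr.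
move: (congr1 (fun z => (c - 1) * (kap + om * f l) * z) tangent).
rewrite mulr0 => {}tangent e1 e2 e3.
by apply/eqP; rewrite mulf_eq0; apply/orP; right; apply/eqP; lra.
Qed.

Lemma unisolvence_curl : a = 0.
Proof.
have [rho [kap [om [fracE r01]]]] := edge_frac_split f.
have flux := face_flux_eq0 fracE.
pose d i := 1 + (c - 1) * (rho + kap * f i).
have d_gt0 i : 0 < d i.
  have /andP[r0 r1] := r01 i.
  rewrite (_ : d i = (1 - (rho + kap * f i)) + c * (rho + kap * f i)); last first.
    by rewrite /d; ring.
  have := mulr_ge0 (ltW c0) r0; move: r1; rewrite le_eqVlt => /predU1P[->|r1].
    by rewrite subrr mulr1 add0r.
  lra.
have d_neq0 i : d i != 0 by apply: lt0r_neq0.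
set s := dotp n a.
have aE : a = tau + s *: n by rewrite /tau subrK.
have tau_grad l :
    dotp tau (bary_grad p l) = - (s * k) * dotp (bary_grad p l) g / d l.
  apply: (canRL (mulfK (d_neq0 l))); apply/eqP.
  rewrite -subr_eq0; apply/eqP; rewrite -[RHS](flux l) /d [in RHS]aE dotpDl dotpZl.
  by rewrite nE dotpZl [dotp (bary_grad p l) g]dotpC; ring.
(* A Moebius function of [f], increasing because [d] is positive: see the
   formula for the differences of [zeta] in the next step. *)
pose zeta i := (f i - f 0) / d i.
have zeta_mon i j : f i != f j -> 0 < (zeta i - zeta j) * (f i - f j).
  move=> fij.
  rewrite (_ : _ * _ = (f i - f j) ^+ 2 * (d 0 / (d i * d j))); last first.
    have di := d_neq0 i; have dj := d_neq0 j; rewrite /zeta; rewrite /d in di dj *.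
    by field; rewrite di dj.
  apply: mulr_gt0; last by rewrite divr_gt0 ?mulr_gt0 ?d_gt0.
  by rewrite exprn_even_gt0//= subr_eq0.
have s0 : s = 0.
  apply/eqP; have := dirichlet_neq0 (sum_bary_grad p) obt zeta_mon Vg vol g0.
  apply: contraNT => s_neq0; apply/eqP.
  have sk0 : - (s * k) != 0 by rewrite oppr_eq0 mulf_neq0.
  apply: (mulfI sk0); rewrite mulr0 mulr_sumr.
  transitivity (dotp tau (tvol p *: g) - f 0 * dotp tau (\sum_i bary_grad p i)).
    rewrite Vg !dotp_sumr mulr_sumr -sumrB; apply: eq_bigr => i _.
    by rewrite dotpZr -mulrBl tau_grad /zeta; ring.
  by rewrite sum_bary_grad dotp0r dotpZr tau_g !mulr0 subrr.
have tau0 : tau = 0.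
  apply: (scalerI vol); rewrite scaler0 -sum_bary_coord big1// => i _.
  by rewrite tau_grad s0 mul0r oppr0 !mul0r scale0r.
by rewrite aE tau0 s0 scale0r addr0.
Qed.

Lemma unisolvence_grad : b = 0.
Proof.
have a0 := unisolvence_curl.
have tau0 : tau = 0 by rewrite /tau a0 dotp0r scale0r subrr.
set m := fun i => Num.min (f i) 0.
set s := (beta - 1) * dotp n b * k.
have diff i : dotp b (p i) = dotp b (p 0) + s * m 0 - s * m i.
  have := circE 0 i; rewrite circ0 tau0 a0 /= !dotp0l dotpBr -/s -/(m _) -/(m _).
  lra.
have nb : dotp n b = 0.
  (* [zeta] is [f] where [f] is nonnegative and [beta * f] elsewhere. *)
  pose zeta i := f i + (beta - 1) * m i.
  have zeta_mon i j : f i != f j -> 0 < (zeta i - zeta j) * (f i - f j).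
    rewrite /zeta /m /Num.min; move: (f i) (f j) => y z yz.
    have : 0 < (y - z) * (y - z) by rewrite -expr2 exprn_even_gt0//= subr_eq0.
    have [y0|y0] := ltP y 0; have [z0|z0] := ltP z 0 => yz0.
    - by have := mulr_gt0 beta0 yz0; lra.
    - have : 0 < (z - y) * (z - beta * y).
        by have := pmulr_rlt0 y beta0; rewrite y0 => by0; apply: mulr_gt0; lra.
      lra.
    - have : 0 < (y - z) * (y - beta * z).
        by have := pmulr_rlt0 z beta0; rewrite z0 => bz0; apply: mulr_gt0; lra.
      lra.
    - lra.
  have := dirichlet_neq0 (sum_bary_grad p) obt zeta_mon Vg vol g0.
  apply: contraNeq => nb_neq0; apply/eqP.
  have kg : k ^+ 2 * dotp g g = 1 by rewrite -n1 nE dotpZl dotpZr; ring.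
  have ng : dotp n b = k * dotp b g by rewrite nE dotpZl dotpC.
  have bg : tvol p * dotp b g = - s * \sum_i m i * dotp (bary_grad p i) g.
    rewrite -dotpZl -sum_dotp_bary_grad dotp_suml.
    under eq_bigr do rewrite dotpZl diff mulrBl.
    rewrite sumrB -mulr_sumr -dotp_suml sum_bary_grad dotp0l mulr0 sub0r.
    rewrite mulNr mulr_sumr.
    by congr (- _); apply: eq_bigr => i _; rewrite mulrA.
  have gg : \sum_i f i * dotp (bary_grad p i) g = tvol p * dotp g g.
    rewrite -dotpZl Vg dotp_suml; by under [RHS]eq_bigr do rewrite dotpZl.
  rewrite /zeta; under eq_bigr do rewrite mulrDl -mulrA.
  rewrite big_split /= -mulr_sumr gg.
  have nbk : dotp n b * k != 0 by rewrite mulf_neq0.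
  apply: (mulfI nbk); rewrite mulr0 mulrDr.
  rewrite [X in _ + X](_ : _ = - (tvol p * dotp b g)); last by rewrite bg /s; ring.
  by rewrite ng -[tvol p * dotp b g]mul1r -kg; ring.
apply: (scalerI vol); rewrite scaler0 -sum_dotp_bary_grad.
under eq_bigr do rewrite diff /s nb mulr0 !mul0r addr0 subr0.
by rewrite -scaler_sumr sum_bary_grad scaler0.
Qed.

End Unisolvence.

(** * The transmission matrices *)

Section Transmission.
Variables (R : realType) (n t1 t2 : 'cV[R]_3).

Let axis := [tuple n; t1; t2].

Lemma frame_mxE i j : frame_mx n t1 t2 i j = tnth axis j i 0.
Proof.
rewrite /frame_mx; elim/ord3_ind: j; rewrite mxE.
- by case: splitP => [j _|//]; rewrite (ord1 j).
- case: splitP => [j|j /= jE]; first by rewrite (ord1 j).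
  by rewrite mxE; case: splitP => m; rewrite (ord1 m) // => mE; move: jE; rewrite mE.
- case: splitP => [j|j /= jE]; first by rewrite (ord1 j).
  by rewrite mxE; case: splitP => m; rewrite (ord1 m) // => mE; move: jE; rewrite mE.
Qed.

Lemma frame_tr_mulmx (u : 'cV[R]_3) j :
  ((frame_mx n t1 t2)^T *m u) j 0 = dotp (tnth axis j) u.
Proof.
by rewrite mxE; apply: eq_bigr => i _; rewrite mxE frame_mxE.
Qed.

Lemma frame_diag_mulmx x y z (u : 'cV[R]_3) :
  frame_mx n t1 t2 *m diag3 x y z *m (frame_mx n t1 t2)^T *m u =
  (x * dotp n u) *: n + (y * dotp t1 u) *: t1 + (z * dotp t2 u) *: t2.
Proof.
apply/matrixP => i j; rewrite ord1 -!mulmxA mxE.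
under eq_bigr do rewrite /diag3 mul_diag_mx mxE frame_tr_mulmx frame_mxE.
by rewrite sum3E !mxE !(tnth_nth 0) /=; ring.
Qed.

Lemma frame_decomp (u : 'cV[R]_3) :
  [/\ enorm n = 1, enorm t1 = 1 & enorm t2 = 1] ->
  [/\ dotp n t1 = 0, dotp n t2 = 0 & dotp t1 t2 = 0] ->
  u = dotp n u *: n + dotp t1 u *: t1 + dotp t2 u *: t2.
Proof.
move=> [/enorm_eq1 nn /enorm_eq1 t11 /enorm_eq1 t22] [nt1 nt2 t12].
have TT : (frame_mx n t1 t2)^T *m frame_mx n t1 t2 = 1%:M.
  apply/matrixP => i j; transitivity (dotp (tnth axis i) (tnth axis j)).
    by rewrite mxE; apply: eq_bigr => m _; rewrite [_^T _ _]mxE !frame_mxE.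
  rewrite mxE; elim/ord3_ind: i; elim/ord3_ind: j;
    by rewrite !(tnth_nth 0) /= // dotpC.
have := frame_diag_mulmx 1 1 1 u; rewrite !mul1r => <-.
rewrite [diag3 _ _ _](_ : _ = 1%:M); last first.
  by apply/matrixP => i j; rewrite !mxE; elim/ord3_ind: i.
by rewrite mulmx1 (mulmx1C TT) mul1mx.
Qed.

End Transmission.

Section TransmissionMatrices.
Variables (R : realType) (n t1 t2 : 'cV[R]_3).
Hypothesis unit_axes : [/\ enorm n = 1, enorm t1 = 1 & enorm t2 = 1].
Hypothesis orth_axes : [/\ dotp n t1 = 0, dotp n t2 = 0 & dotp t1 t2 = 0].

Lemma A_mx_mulmx cp cm (a : 'cV[R]_3) :
  A_mx (frame_mx n t1 t2) cp cm *m a =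
  a + (cp / cm - 1) *: (a - dotp n a *: n).
Proof.
rewrite frame_diag_mulmx mul1r.
have dec := frame_decomp a unit_axes orth_axes.
have -> : a - dotp n a *: n = dotp t1 a *: t1 + dotp t2 a *: t2.
  by apply/eqP; rewrite subr_eq addrC addrA {1}dec.
by rewrite {4}dec; apply/matrixP => i j; rewrite !mxE; ring.
Qed.

Lemma B_mx_mulmx cp cm (b : 'cV[R]_3) :
  B_mx (frame_mx n t1 t2) cp cm *m b =
  b + ((cp / cm - 1) * dotp n b) *: n.
Proof.
rewrite frame_diag_mulmx !mul1r.
have dec := frame_decomp b unit_axes orth_axes.
by rewrite {4}dec; apply/matrixP => i j; rewrite !mxE; ring.
Qed.

End TransmissionMatrices.

(** * Edge degrees of freedom *)

Section EdgeDof.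
Variables (R : realType) (p : 'I_4 -> 'cV[R]_3) (phi : 'cV[R]_3 -> R).
Hypothesis phi_aff : is_affine phi.

Lemma affine_bary (l : 'I_4 -> R) : \sum_i l i = 1 ->
  phi (\sum_i l i *: p i) = \sum_i l i * phi (p i).
Proof.
case: phi_aff => g [c phiE] l1; rewrite phiE dotp_sumr.
under [RHS]eq_bigr do rewrite phiE mulrDr.
rewrite big_split /= -mulr_suml l1 mul1r; congr (_ + _).
by apply: eq_bigr => i _; rewrite dotpZr.
Qed.

Lemma tetra_edge i j u : 0 <= u <= 1 -> tetra p (p i + u *: (p j - p i)).
Proof.
move=> /andP[u0 u1].
have delta k : \sum_m (m == k)%:R *: p m = p k.
  by rewrite (bigD1 k)//= eqxx scale1r big1 ?addr0// => m /negbTE->; rewrite scale0r.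
have delta1 (k : 'I_4) : \sum_m (m == k)%:R = 1 :> R.
  by rewrite (bigD1 k)//= eqxx big1 ?addr0// => m /negbTE->.
exists (fun m => (1 - u) * (m == i)%:R + u * (m == j)%:R); split.
- by move=> m; rewrite addr_ge0// mulr_ge0 ?ler0n// subr_ge0.
- by rewrite big_split /= -!mulr_sumr !delta1 !mulr1 subrK.
- under eq_bigr do rewrite scalerDl -!scalerA.
  rewrite big_split /= -!scaler_sumr !delta.
  by rewrite scalerBl scale1r scalerBr addrAC addrA.
Qed.

Lemma affine_edge i j u :
  phi (p i + u *: (p j - p i)) = phi (p i) + u * (phi (p j) - phi (p i)).
Proof.
by case: phi_aff => g [c phiE]; rewrite !phiE !(dotpDr, dotpZr, dotpNr); ring.
Qed.

(** The factor [c * enorm (edge_vec p k)] is 1 or -1 when [t] has norm 1. *)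
Lemma edge_dofE (v a b : 'cV[R]_3 -> 'cV[R]_3)
    (x ap am bp bm t : 'cV[R]_3) c k :
  (forall y, Kplus p phi y -> a y = ap) ->
  (forall y, Kminus p phi y -> a y = am) ->
  (forall y, Kplus p phi y -> b y = bp) ->
  (forall y, Kminus p phi y -> b y = bm) ->
  (forall y, tetra p y -> v y = crossp (a y) (y - x) + b y) ->
  t = c *: edge_vec p k -> 0 < enorm (edge_vec p k) ->
  edge_dof p k t v = c * enorm (edge_vec p k) *
    edge_circ p (phi \o p) x ap am bp bm (tnth edges k).1 (tnth edges k).2.
Proof.
move=> hap ham hbp hbm vE -> {t}.
rewrite /edge_dof /edge_vec /edge_end /edge_start.
set i := (tnth edges k).1; set j := (tnth edges k).2; set len := enorm _ => len0.
pose val (a b : 'cV[R]_3) :=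
  c * (dotp a (crossp (p i - x) (p j - x)) + dotp b (p j - p i)).
have valE a' b' s :
    dotp (crossp a' (p i + s *: (p j - p i) - x) + b') (c *: (p j - p i)) = val a' b'.
  by rewrite /val !coordE; ring.
have in_edge s : 0 <= s <= len -> tetra p (p i + (s / len) *: (p j - p i)).
  move=> /andP[s0 sl]; apply/tetra_edge/andP; split.
      by rewrite divr_ge0// ltW.
    by rewrite ler_pdivrMr// mul1r.
have scaled s : len * (phi (p i) + s / len * (phi (p j) - phi (p i))) =
    phi (p i) * (len - s) + phi (p j) * s by field; rewrite lt0r_neq0.
(* [scaled s] is the value of [phi] at arc length [s], times [len]. *)
have neg s : 0 <= s <= len -> phi (p i) * (len - s) + phi (p j) * s < 0 ->
    dotp (v (p i + (s / len) *: (p j - p i))) (c *: (p j - p i)) = val am bm.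
  move=> s01 phi_neg; have T := in_edge _ s01.
  have K : Kminus p phi (p i + (s / len) *: (p j - p i)).
    by split=> //=; rewrite affine_edge -(pmulr_rlt0 _ len0) scaled.
  by rewrite vE// ham// hbm// valE.
have pos s : 0 <= s <= len -> 0 <= phi (p i) * (len - s) + phi (p j) * s ->
    dotp (v (p i + (s / len) *: (p j - p i))) (c *: (p j - p i)) = val ap bp.
  move=> s01 phi_pos; have T := in_edge _ s01.
  have K : Kplus p phi (p i + (s / len) *: (p j - p i)).
    by split=> //=; rewrite affine_edge -(pmulr_rge0 _ len0) scaled.
  by rewrite vE// hap// hbp// valE.
rewrite /edge_circ /edge_frac /=.
move: (phi (p i)) (phi (p j)) neg pos => y z neg pos.
have len_ge0 := ltW len0.
have [y0|y0] := ltP y 0; have [z0|z0] := ltP z 0.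
- rewrite (@Rintegral_step _ _ len len (val am bm) 0); first by rewrite /val; ring.
  + by rewrite len_ge0 lexx.
  + move=> s /andP[s0 sl]; apply: neg; first by rewrite s0 ltW.
    have : y * (len - s) < 0 by rewrite nmulr_rlt0 ?subr_gt0.
    have : z * s <= 0 by rewrite nmulr_rle0.
    lra.
  + by move=> s; case: ltgtP.
- have yz0 : 0 < z - y by lra.
  have cut : len * (y / (y - z)) = len * - y / (z - y).
    by field; rewrite ?(gt_eqF yz0) ?lt_eqF//; lra.
  rewrite (@Rintegral_step _ _ len (len * - y / (z - y)) (val am bm) (val ap bp)).
  + by rewrite -cut /val; ring.
  + rewrite divr_ge0 ?mulr_ge0 ?oppr_ge0 ?(ltW y0) ?(ltW yz0)//= ler_pdivrMr//.
    by rewrite ler_pM2l//; lra.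
  + move=> s /andP[s0]; rewrite ltr_pdivlMr// => sl; apply: neg; last by lra.
    by rewrite s0 /= -(ler_pM2r yz0); have := mulr_ge0 len_ge0 z0; lra.
  + move=> s /andP[]; rewrite ltr_pdivrMr// => sl s_len; apply: pos; last by lra.
    have ly0 : 0 <= len * - y by rewrite mulr_ge0// oppr_ge0 ltW.
    by rewrite s_len andbT -(pmulr_lge0 _ yz0); lra.
- have yz0 : 0 < y - z by lra.
  have cut : len * (z / (z - y)) = len - len * y / (y - z).
    by field; rewrite ?(gt_eqF yz0) ?lt_eqF//; lra.
  rewrite (@Rintegral_step _ _ len (len * y / (y - z)) (val ap bp) (val am bm)).
  + rewrite -[len * y / (y - z)](subKr len) -cut /val; ring.
  + rewrite divr_ge0 ?mulr_ge0 ?(ltW yz0)//= ler_pdivrMr//.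
    by rewrite ler_pM2l//; lra.
  + move=> s /andP[s0]; rewrite ltr_pdivlMr// => sl; apply: pos; last by lra.
    rewrite s0 /= -(ler_pM2r yz0).
    have : len * z <= 0 by rewrite pmulr_rle0// ltW.
    lra.
  + move=> s /andP[]; rewrite ltr_pdivrMr// => sl s_len; apply: neg; last by lra.
    have ly0 : 0 <= len * y by rewrite mulr_ge0.
    by rewrite s_len andbT -(pmulr_lge0 _ yz0); lra.
- rewrite (@Rintegral_step _ _ len len (val ap bp) 0); first by rewrite /val; ring.
  + by rewrite len_ge0 lexx.
  + move=> s /andP[s0 sl]; apply: pos; first by rewrite s0 ltW.
    by rewrite addr_ge0// mulr_ge0// subr_ge0 ltW.
  + by move=> s; case: ltgtP.
Qed.

End EdgeDof.

(** * The normal to the interface *)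

Section InterfaceNormal.
Variables (R : realType) (p : 'I_4 -> 'cV[R]_3) (phi : 'cV[R]_3 -> R).

Lemma interface_element_signs : interface_element p phi ->
  exists i j, phi (p i) < 0 /\ 0 < phi (p j).
Proof.
case=> _ _ mM0.
have [i i0] : exists i, phi (p i) < 0.
  apply: contrapT => /forallNP all_ge0; move: mM0; apply/negP; rewrite -leNgt.
  have {}all_ge0 i : 0 <= phi (p i) by rewrite leNgt; apply/negP.
  rewrite mulr_ge0//; first by apply: le_bigmin.
  exact: le_trans (all_ge0 ord0) (bigmax_ge_id _ _ _ _).
have [j j0] : exists j, 0 < phi (p j).
  apply: contrapT => /forallNP all_le0; move: mM0; apply/negP; rewrite -leNgt.
  have {}all_le0 j : phi (p j) <= 0 by rewrite leNgt; apply/negP.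
  rewrite mulr_le0//; last by apply: bigmax_le.
  exact: le_trans (bigmin_le_id _ _ _ _) (all_le0 ord0).
by exists i, j.
Qed.

(** An affine function that changes sign at the vertices vanishes at an interior
    point: correct the barycenter by moving it towards one vertex. *)
Lemma interior_zero (f : 'I_4 -> R) i j : f i < 0 -> 0 < f j ->
  exists l : 'I_4 -> R,
    [/\ forall m, 0 < l m, \sum_m l m = 1 & \sum_m l m * f m = 0].
Proof.
move=> fi fj.
have [m [w [w0 wf]]] : exists m w, 0 <= w /\ \sum_k f k + w * f m = 0.
  have [s0|s0] := leP 0 (\sum_k f k).
    exists i, (- (\sum_k f k) / f i); split; last by field; rewrite lt_eqF.
    by rewrite -mulrNN opprK -invrN divr_ge0// oppr_ge0 ltW.
  exists j, (- (\sum_k f k) / f j); split; last by field; rewrite lt0r_neq0.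
  by rewrite divr_ge0// ?oppr_ge0 ltW.
have W0 : 0 < 4 + w by lra.
have delta (F : 'I_4 -> R) : \sum_k (k == m)%:R * F k = F m.
  rewrite (bigD1 m)//= eqxx mul1r big1 ?addr0// => k /negbTE->.
  by rewrite mul0r.
exists (fun k => (1 + (k == m)%:R * w) / (4 + w)); split.
- by move=> k; rewrite divr_gt0// ltr_wpDr// mulr_ge0 ?ler0n.
- rewrite -mulr_suml big_split /= delta sumr_const card_ord.
  by rewrite divff// lt0r_neq0.
- under eq_bigr do rewrite mulrAC mulrDl mul1r -mulrA.
  by rewrite -mulr_suml big_split /= (delta (fun k => w * f k)) wf mul0r.
Qed.

(** The interface contains a point interior to the tetrahedron, hence a small
    segment in every direction orthogonal to the gradient of [phi]. *)
Lemma interface_normal g e n : interface_element p phi ->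
  (forall x, phi x = dotp g x + e) ->
  (forall x y, interface p phi x -> interface p phi y -> dotp n (x - y) = 0) ->
  exists k, n = k *: g.
Proof.
move=> elt phiE n_perp; have [indep phi_aff _] := elt.
have vol := tvol_neq0 indep.
have [i [j [fi fj]]] := interface_element_signs elt.
have g0 : dotp g g != 0.
  rewrite dotp_eq0; apply: contraTneq fj => g0; rewrite -leNgt.
  by move: fi; rewrite !phiE g0 !dotp0l => /ltW.
have [l [l0 l1 lphi]] := @interior_zero (phi \o p) i j fi fj.
pose k := dotp n g / dotp g g; pose tau := n - k *: g.
have tau_g : dotp tau g = 0 by rewrite dotpBl dotpZl divfK// subrr.
pose mu m := dotp tau (bary_grad p m) / tvol p.
have sum_mu : \sum_m mu m = 0.
  by rewrite -mulr_suml -dotp_sumr sum_bary_grad dotp0r mul0r.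
have tauE : tau = \sum_m mu m *: p m.
  apply: (scalerI vol); rewrite -sum_bary_coord scaler_sumr.
  by apply: eq_bigr => m _; rewrite scalerA /mu mulrC divfK.
have [eps eps0 eps_le] : exists2 eps, 0 < eps & forall m, 0 <= l m + eps * mu m.
  (* The step is the minimum of 1 and of one admissible step for each
     barycentric coordinate. *)
  pose ratio m := l m / (1 + `|mu m|).
  have ratio_gt0 m : 0 < ratio m by rewrite divr_gt0// ltr_pwDl.
  exists (\big[Num.min/1]_m ratio m); first by apply: lt_bigmin.
  move=> m; have : `|\big[Num.min/1]_m ratio m * mu m| <= l m.
    rewrite normrM ger0_norm; last by apply: le_bigmin => // k' _; exact: ltW.
    have min_le : \big[Num.min/1]_m ratio m <= ratio m by apply: bigmin_le.
    apply: le_trans (ler_wpM2r (normr_ge0 _) min_le) _.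
    rewrite /ratio mulrAC ler_pdivrMr ?ltr_pwDl// ler_pM2l// lerDr.
    exact: ler01.
  by rewrite ler_norml => /andP[+ _]; lra.
have x_in : interface p phi (\sum_m l m *: p m).
  split; last by rewrite /= affine_bary.
  by exists l; split=> // m; rewrite ltW.
have sum1 : \sum_m (l m + eps * mu m) = 1.
  by rewrite big_split /= l1 -mulr_sumr sum_mu mulr0 addr0.
have xE : \sum_m (l m + eps * mu m) *: p m = \sum_m l m *: p m + eps *: tau.
  rewrite tauE scaler_sumr -big_split; apply: eq_bigr => m _.
  by rewrite scalerDl scalerA.
have y_in : interface p phi (\sum_m l m *: p m + eps *: tau).
  split; first by exists (fun m => l m + eps * mu m); rewrite -xE.
  have [_ /= x0] := x_in.
  by rewrite /= phiE dotpDr dotpZr [dotp g tau]dotpC tau_g mulr0 addr0 -phiE.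
have n_tau : dotp n tau = 0.
  have := n_perp _ _ y_in x_in; rewrite addrC addKr dotpZr => /eqP.
  by rewrite mulf_eq0 gt_eqF//= => /eqP.
exists k; apply/eqP; rewrite -subr_eq0 -/tau -dotp_eq0 {1}/tau.
by rewrite dotpBl dotpZl n_tau dotpC tau_g mulr0 subrr.
Qed.

End InterfaceNormal.

(** * Unisolvence of the edge degrees of freedom *)

Lemma linear_inj_surj (R : fieldType) m (L : {linear 'rV[R]_m -> 'rV[R]_m}) :
  (forall u, L u = 0 -> u = 0) -> forall w, exists u, L u = w.
Proof.
move=> injL w; have : row_free (lin1_mx L).
  rewrite -kermx_eq0; apply/eqP/row_matrixP => i; rewrite row0; apply: injL.
  by rewrite -mul_rV_lin1 -row_mul mulmx_ker row0.
rewrite row_free_unit => uL; exists (w *m invmx (lin1_mx L)).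
by rewrite -mul_rV_lin1 mulmxKV.
Qed.

Theorem lemma3p2 (R : realType)
    (p : 'I_4 -> 'cV[R]_3) (phi : 'cV[R]_3 -> R)
    (alphap alpham betap betam : R) (xK n t1 t2 : 'cV[R]_3)
    (t : 'I_6 -> 'cV[R]_3)
    (HK : interface_element p phi)
    (Hshape : trirectangular p \/ regular p)
    (Halphap : 0 < alphap) (Halpham : 0 < alpham)
    (Hbetap : 0 < betap) (Hbetam : 0 < betam)
    (HxK : interface p phi xK)
    (Hframe : interface_frame p phi n t1 t2)
    (Ht : forall k, unit_tangent p k (t k)) :
  let S := edge_space p phi (frame_mx n t1 t2)
             alphap alpham betap betam xK in
  forall w : 'I_6 -> R,
  exists v : 'cV[R]_3 -> 'cV[R]_3,
    [/\ S v,
        (forall k, edge_dof p k (t k) v = w k) &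
        (forall v', S v' -> (forall k, edge_dof p k (t k) v' = w k) ->
           forall x, tetra p x -> v' x = v x)].
Proof.
move=> S w.
have [indep phi_aff _] := HK; have [g [e phiE]] := phi_aff.
have [n_perp unit_axes orth_axes] := Hframe.
have [k nE] := interface_normal HK phiE n_perp.
have nn : dotp n n = 1 by case: unit_axes => /enorm_eq1.
have fE i : (phi \o p) i = dotp g (p i - xK).
  have [_ /= xK0] := HxK.
  by rewrite /= -[LHS]subr0 -xK0 !phiE dotpBr; ring.
pose A := A_mx (frame_mx n t1 t2) alphap alpham.
pose B := B_mx (frame_mx n t1 t2) betap betam.
pose circ a b (l : 'I_6) :=
  edge_circ p (phi \o p) xK a (A *m a) b (B *m b)
    (tnth edges l).1 (tnth edges l).2.
have circ_inj a b : (forall l, circ a b l = 0) -> a = 0 /\ b = 0.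
  move=> /edge_circ_all; rewrite A_mx_mulmx// B_mx_mulmx// => circ0.
  have alpha0 : 0 < alphap / alpham by rewrite divr_gt0.
  have beta0 : 0 < betap / betam by rewrite divr_gt0.
  have obt i j := @dotp_bary_grad_le0 R p i j Hshape.
  have vol := tvol_neq0 indep.
  split; first exact: (unisolvence_curl fE nE nn alpha0 vol obt circ0).
  exact: (unisolvence_grad fE nE nn alpha0 beta0 vol obt circ0).
(* [v] belongs to the space, with the plus values [ap] and [bp]. *)
pose rep v ap bp := exists a b,
  [/\ [/\ forall x, Kplus p phi x -> a x = ap
         & forall x, Kminus p phi x -> a x = A *m ap],
      [/\ forall x, Kplus p phi x -> b x = bp
         & forall x, Kminus p phi x -> b x = B *m bp]
    & forall x, tetra p x -> v x = crossp (a x) (x - xK) + b x].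
have scale l : exists r, r != 0 /\ forall v ap bp, rep v ap bp ->
    edge_dof p l (t l) v = r * circ ap bp l.
  have [t_unit [c tE]] := Ht l.
  have c_e : c ^+ 2 * dotp (edge_vec p l) (edge_vec p l) = 1.
    by rewrite -(enorm_eq1 t_unit) tE dotpZl dotpZr; ring.
  have len0 : 0 < enorm (edge_vec p l).
    rewrite sqrtr_gt0 lt0r dotp_ge0 andbT; apply/eqP => e0.
    by move: c_e; rewrite e0 mulr0 => /eqP; rewrite eq_sym oner_eq0.
  exists (c * enorm (edge_vec p l)); split; last first.
    move=> v ap bp [a [b [[ha ha'] [hb hb'] vE]]].
    exact: (edge_dofE phi_aff ha ha' hb hb' vE tE len0).
  rewrite mulf_neq0 ?(lt0r_neq0 len0)//; apply: contra_eq_neq c_e => ->.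
  by rewrite expr0n mul0r eq_sym oner_eq0.
have [r rP] := choice scale.
have circ_lin z a b a' b' l :
    circ (z *: a + a') (z *: b + b') l = z * circ a b l + circ a' b' l.
  by rewrite /circ !mulmxDr -!scalemxAr edge_circ_linear.
(* A row vector of length 6 encodes the pair [(ap, bp)]. *)
pose lpart (u : 'rV[R]_(3 + 3)) := (lsubmx u)^T.
pose rpart (u : 'rV[R]_(3 + 3)) := (rsubmx u)^T.
pose L (u : 'rV[R]_(3 + 3)) : 'rV[R]_(3 + 3) := \row_l circ (lpart u) (rpart u) l.
have L_lin : linear L.
  move=> z u u'; apply/rowP => l; rewrite !mxE -circ_lin /lpart /rpart.
  by rewrite !linearD !linearZ.
have L_inj u : L u = 0 -> u = 0.
  move=> Lu; have [l|u1 u2] := @circ_inj (lpart u) (rpart u).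
    by have := congr1 (fun M : 'rV_6 => M 0 l) Lu; rewrite !mxE.
  rewrite -[u]hsubmxK -[lsubmx u]trmxK -[rsubmx u]trmxK.
  by rewrite -/(lpart u) -/(rpart u) u1 u2 !trmx0 row_mx0.
pose Lf : {linear 'rV[R]_(3 + 3) -> 'rV[R]_(3 + 3)} :=
  HB.pack L (GRing.isLinear.Build _ _ _ _ L L_lin).
have [u Lu] := @linear_inj_surj R (3 + 3) Lf L_inj (\row_l (w l / r l)).
pose step (cp cm : 'cV[R]_3) x := if 0 <= phi x then cp else cm.
have step_plus cp cm x : Kplus p phi x -> step cp cm x = cp.
  by case=> _ /= h; rewrite /step h.
have step_minus cp cm x : Kminus p phi x -> step cp cm x = cm.
  by case=> _ /= h; rewrite /step leNgt h.
have rep_step : rep (fun x => crossp (step (lpart u) (A *m lpart u) x) (x - xK) +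
    step (rpart u) (B *m rpart u) x) (lpart u) (rpart u).
  exists (step (lpart u) (A *m lpart u)), (step (rpart u) (B *m rpart u)).
  by split=> //; split=> x; [exact: step_plus|exact: step_minus|
    exact: step_plus|exact: step_minus].
have rep_inj v ap bp : rep v ap bp ->
    (forall l, edge_dof p l (t l) v = w l) -> ap = lpart u /\ bp = rpart u.
  move=> v_rep v_dof.
  pose u' : 'rV[R]_(3 + 3) := row_mx ap^T bp^T.
  have [lu' ru'] : lpart u' = ap /\ rpart u' = bp.
    by rewrite /lpart /rpart row_mxKl row_mxKr !trmxK.
  suff -> : u = u' by rewrite lu' ru'.
  apply/eqP; rewrite -subr_eq0; apply/eqP/L_inj.
  rewrite -[L _]/(Lf _) linearB Lu; apply/eqP; rewrite subr_eq0; apply/eqP/rowP => l.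
  rewrite !mxE lu' ru' -v_dof; have [rl /(_ _ _ _ v_rep) ->] := rP l.
  by rewrite mulrC mulKf.
exists (fun x => crossp (step (lpart u) (A *m lpart u) x) (x - xK) +
    step (rpart u) (B *m rpart u) x); split.
- have [a [b [[ha ha'] [hb hb'] vE]]] := rep_step.
  by exists a, b; split=> //; [exists (lpart u), (A *m lpart u)|
    exists (rpart u), (B *m rpart u)].
- move=> l; have [rl /(_ _ _ _ rep_step) ->] := rP l.
  have := congr1 (fun M : 'rV_6 => M 0 l) Lu; rewrite !mxE => ->.
  by rewrite mulrC divfK.
move=> v' [a [b [[ap [am [-> ha ha']]] [bp [bm [-> hb hb']]] v'E]]] v'_dof x xK'.
have v'_rep : rep v' ap bp by exists a, b.
have [apE bpE] := rep_inj _ _ _ v'_rep v'_dof; rewrite v'E// /step.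
case: ifPn => phix.
  by rewrite ha ?hb ?apE ?bpE.
by rewrite ha' ?hb' ?apE ?bpE //; split=> //=; rewrite ltNge.
Qed.
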